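(* Let $\Gamma=\langle\alpha,\beta\rangle$ be a numerical semigroup, where $\alpha<\beta$ are coprime positive integers, and suppose that $\alpha$ is odd and $\beta$ is even. Then, counted up to isomorphism, there are in total \[ \binom{\lfloor\frac{\alpha}{2}\rfloor+\lfloor\frac{\beta}{2}\rfloor}{\lfloor\frac{\alpha}{2}\rfloor} \] selfdual $\Gamma$-semimodules. In particular there are exactly \[ \binom{\lfloor\frac{\alpha}{2}\rfloor}{\ell}\binom{\frac{\beta}{2}-1}{\ell} \] selfdual $\Gamma$-semimodules with $2\ell+1$ (minimal) generators for each $\ell=0,\ldots,\lfloor\frac{\alpha}{2}\rfloor$, and exactly \[ \binom{\lfloor\frac{\alpha}{2}\rfloor}{\ell}\binom{\frac{\beta}{2}-1}{\ell-1} \] selfdual $\Gamma$-semimodules with $2\ell$ (minimal) generators for each $\ell=1,\ldots,\lfloor\frac{\alpha}{2}\rfloor$.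
   Context: Here $\mathbb{N}=\{0,1,2,\ldots\}$. A numerical semigroup $\Gamma$ is a submonoid of $(\mathbb{N},+)$ with finite complement in $\mathbb{N}$; $\langle\alpha,\beta\rangle=\{r\alpha+s\beta : r,s\in\mathbb{N}\}$. A $\Gamma$-semimodule is a non-empty subset $\Delta\subseteq\mathbb{Z}$ that is bounded below and satisfies $\Delta+\Gamma\subseteq\Delta$. A system of generators of $\Delta$ is a subset $\mathcal{E}\subseteq\Delta$ with $\bigcup_{x\in\mathcal{E}}(x+\Gamma)=\Delta$; every $\Gamma$-semimodule has a unique minimal system of generators, which is finite, and ''number of generators'' means its cardinality. A map $f:\Delta\to\Delta'$ of $\Gamma$-semimodules is a homomorphism if $f(\gamma+x)=\gamma+f(x)$ for all $\gamma\in\Gamma$, $x\in\Delta$; $\Delta$ and $\Delta'$ are isomorphic if there is a bijective homomorphism between them, equivalently $\Delta'=\Delta+c$ for some $c\in\mathbb{Z}$. The dual of $\Delta$ is $\Delta^*=\{c\in\mathbb{Z} : c+\Delta\subseteq\Gamma\}$, and $\Delta$ is called selfdual if $\Delta^*\cong\Delta$. Binomial coefficients $\binom{m}{k}$ with $k>m\geq 0$ are $0$. *)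

(* Defs.v *)
From HB Require Import structures.
From mathcomp Require Import all_boot all_order all_algebra.
From mathcomp Require Import boolp classical_sets functions cardinality.

Set Implicit Arguments.
Unset Strict Implicit.
Unset Printing Implicit Defensive.

Import Order.TTheory GRing.Theory Num.Theory.

Local Open Scope classical_set_scope.
Local Open Scope card_scope.

Definition numerical_semigroup (G : set nat) : Prop :=
  [/\ G 0%N, forall a b, G a -> G b -> G (a + b)%N & finite_set (~` G)].

Definition semigroup2 (alpha beta : nat) : set nat :=
  [set n | exists r s : nat, n = (r * alpha + s * beta)%N].

Lemma numerical_semigroup2 (alpha beta : nat) :
  (0 < alpha)%N -> (0 < beta)%N -> coprime alpha beta ->
  numerical_semigroup (semigroup2 alpha beta).
Proof.
move=> a0 b0 co; split.
- by exists 0%N, 0%N.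
- move=> _ _ [r [s ->]] [r' [s' ->]]; exists (r + r')%N, (s + s')%N.
  by rewrite !mulnDl addnACA.
- apply: (@sub_finite_set _ _ `I_(beta * alpha)); last exact: finite_II.
  move=> n /= nG; rewrite ltnNge; apply/negP => len; apply: nG.
  case: (egcdnP beta a0) => u v e _.
  rewrite (eqP co) in e.
  pose r := ((n * u) %% beta)%N.
  have ler : (r * alpha <= n)%N.
    by apply: leq_trans len; rewrite leq_pmul2r // ltnW // ltn_pmod.
  have /dvdnP[s es] : (beta %| n - r * alpha)%N.
    rewrite -eqn_mod_dvd // modnMml -mulnA e mulnDr muln1 mulnA.
    by rewrite modnMDl.
  by exists r, s; rewrite -es subnKC.
Qed.

Section Semimodules.
Variable G : set nat.
Implicit Types D E : set int.

Definition semimodule D : Prop :=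
  [/\ D !=set0, has_lbound D &
      forall x (g : nat), D x -> G g -> D (x + g%:Z)%R].

Definition generating_system D E : Prop :=
  E `<=` D /\ \bigcup_(x in E) [set (x + g%:Z)%R | g in G] = D.

Definition minimal_generating_system D E : Prop :=
  generating_system D E /\
  forall E', E' `<=` E -> generating_system D E' -> E' = E.

Definition has_num_generators (k : nat) D : Prop :=
  exists2 E, minimal_generating_system D E & E #= `I_k.

(* Maps D -> D' are represented by functions on int; only their values on D
   matter. *)
Definition homomorphism D D' (f : int -> int) : Prop :=
  set_fun D D' f /\
  forall (g : nat) x, G g -> D x -> f (g%:Z + x)%R = (g%:Z + f x)%R.

Definition isomorphic D D' : Prop :=
  exists2 f : int -> int, homomorphism D D' f & set_bij D D' f.

Definition dual D : set int :=
  [set c | forall x, D x -> exists2 g : nat, G g & (c + x)%R = g%:Z%R].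

Definition selfdual D : Prop := semimodule D /\ isomorphic (dual D) D.

Definition iso_class D : set (set int) :=
  [set D' | semimodule D' /\ isomorphic D D'].

Definition num_up_to_iso (P : set (set int)) (n : nat) : Prop :=
  iso_class @` P #= `I_n.

End Semimodules.

(* Main.v *)
Require Import Defs.
From HB Require Import structures.
From mathcomp Require Import all_boot all_order all_algebra.
From mathcomp Require Import boolp classical_sets functions cardinality.
From mathcomp Require Import zify.

(** Write [alpha = 2a + 1], [beta = 2b] and [G = <alpha, beta>].

    Every integer is [i * beta + j * alpha], uniquely once [i] is confined to a
    window of [alpha] consecutive integers.  In these coordinates [G] is
    symmetric: [n] is in [G] exactly when [F - n] is not, where
    [F = alpha * beta - alpha - beta].  Hence the dual of a semimodule [D] is
    the complement of [D] reflected by [x |-> F - x] ([dual_semigroup2]), and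
    [D] is selfdual exactly when some reflection [x |-> N - x] exchanges [D]
    and its complement ([selfdualP]).  The number [N] is determined by [D], is
    odd (otherwise [N / 2] would be both inside and outside [D]), and changes
    by [2c] when [D] is shifted by [c].  As [alpha] is odd, every isomorphism
    class of selfdual semimodules contains exactly one [D] with [N = - alpha],
    so these normalised [D] have to be counted.

    Use the window [- a <= i <= a].  A semimodule is the set of points with
    [j >= h i] for some nonincreasing [h], and [N = - alpha] says that [h] is
    odd.  So [D] is determined by [0 <= - h 1 <= ... <= - h a], and going once
    around the period ([alpha * beta = beta * alpha]) bounds [- h a] by [b].
    Encoding the sequence by its increments gives a bijection between
    normalised selfdual semimodules and lists of [a] natural numbers with sum at
    most [b] ([staircase], [antisymmetric_staircase], [staircase_inj]); there
    are ['C(a + b, a)] of them.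

    A point is a minimal generator when neither [x - alpha] nor [x - beta] is
    in [D], that is, at the corners of the staircase.  Each nonzero increment
    gives two corners, one on each side of the centre, and there is one more
    corner at the seam of the period when the sum is less than [b]
    ([size_corner_columns]).  So the parity of the number of generators tells
    whether the sum is [b], and the refined counts follow from the number
    ['C(a, l) * 'C(m, l)] of lists of length [a] with [l] nonzero entries and
    sum at most [m] ([count_ascents]). *)

Set Implicit Arguments.
Unset Strict Implicit.
Unset Printing Implicit Defensive.

Import Order.TTheory GRing.Theory Num.Theory.

Local Open Scope classical_set_scope.
Local Open Scope card_scope.
Local Open Scope nat_scope.

(** * Counting lists by sum and by number of nonzero entries *)

Fixpoint increments (a m : nat) : seq (seq nat) :=
  if a is a'.+1 then
    flatten [seq [seq v :: d | d <- increments a' (m - v)] | v <- iota 0 m.+1]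
  else [:: [::]].

(** A nonzero increment is an ascent of the sequence of partial sums. *)
Definition ascents (d : seq nat) : nat := count (ltn 0) d.

Lemma mem_increments a m d :
  (d \in increments a m) = (size d == a) && (sumn d <= m).
Proof.
elim: a m d => [|a IHa] m d; first by case: d.
apply/flatten_mapP/idP => [[v] | ].
  rewrite (mem_iota 0 m.+1) => lev /mapP[d']; rewrite IHa => /andP[/eqP <- le_sum] ->.
  by rewrite /= eqxx /=; lia.
case: d => [|v d] //=; rewrite eqSS => /andP[/eqP sz le_sum].
exists v; first by rewrite (mem_iota 0 m.+1); lia.
by apply/map_f; rewrite IHa sz eqxx /=; lia.
Qed.

Lemma uniq_increments a m : uniq (increments a m).
Proof.
elim: a m => [|a IHa] m //; apply: allpairs_uniq_dep; first exact: iota_uniq.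
  by move=> v _; exact: IHa.
by move=> [v d] [v' d'] _ _ /= [-> ->].
Qed.

Lemma hockey_stick n m : \sum_(v < m) 'C(v, n) = 'C(m, n.+1).
Proof. by elim: m => [|m IHm]; rewrite ?big_ord0 // big_ord_recr /= IHm binS addnC. Qed.

Lemma count_increments_cons (P : pred (seq nat)) a m :
  count P (increments a.+1 m) =
    \sum_(v < m.+1) count (fun d => P ((v : nat) :: d)) (increments a (m - v)).
Proof.
rewrite /= -[_ ++ _]/(increments a.+1 m) count_flatten sumnE !big_map.
pose F v := count (fun d => P (v :: d)) (increments a (m - v)).
rewrite -[RHS](big_mkord xpredT F).
rewrite /index_iota subn0; apply: eq_bigr => v _.
by rewrite count_map.
Qed.

(** By induction on the length, splitting on the head.  Lists with head 0
    contribute ['C(a, l) * 'C(m, l)]; the other heads contribute, by the hockey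
    stick identity, ['C(a, l - 1) * 'C(m, l)] (nothing when [l = 0]); Pascal's
    rule adds the two. *)
Lemma count_ascents a m l :
  count (fun d => ascents d == l) (increments a m) = 'C(a, l) * 'C(m, l).
Proof.
elim: a m l => [|a IHa] m l; first by case: l => [|l]; rewrite ?bin0.
rewrite count_increments_cons big_ord_recl /= subn0.
have -> : count (fun d => ascents (0 :: d) == l) (increments a m) = 'C(a, l) * 'C(m, l).
  by rewrite -IHa; apply: eq_count => d.
case: l => [|l].
  rewrite big1 ?bin0 ?addn0 // => v _.
  by rewrite (eq_count (a2 := pred0)) ?count_pred0.
have -> : \sum_(v < m) count (fun d => ascents (bump 0 v :: d) == l.+1)
             (increments a (m - bump 0 v)) = \sum_(v < m) 'C(a, l) * 'C(v, l).
  rewrite [RHS](reindex_inj rev_ord_inj); apply: eq_bigr => v _ /=.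
  by rewrite -IHa; apply: eq_count => d; rewrite /ascents /= eqSS.
by rewrite -big_distrr /= hockey_stick binS; lia.
Qed.

Lemma size_increments a m : size (increments a m) = 'C(a + m, a).
Proof.
rewrite -count_predT; elim: a m => [|a IHa] m; first by rewrite bin0.
rewrite count_increments_cons.
under eq_bigr => v _ do rewrite IHa.
rewrite (reindex_inj rev_ord_inj) /=.
have -> : 'C(a.+1 + m, a.+1) = \sum_(v < m.+1) 'C(a + v, a).
  elim: m => [|m IHm]; first by rewrite big_ord1 !addn0 !binn.
  by rewrite big_ord_recr /= -IHm addSnnS addnS binS addSnnS addnC addnS.
by apply: eq_bigr => v _; congr 'C(_, _); have := ltn_ord v; lia.
Qed.

Lemma perm_increments_lt a m :
  perm_eq [seq d <- increments a m.+1 | sumn d < m.+1] (increments a m).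
Proof.
apply: uniq_perm; rewrite ?filter_uniq ?uniq_increments // => d.
by rewrite mem_filter !mem_increments ltnS; case: (size d == a); lia.
Qed.

Lemma count_ascents_lt a m l :
  count (fun d => (sumn d < m.+1) && (ascents d == l)) (increments a m.+1)
  = 'C(a, l) * 'C(m, l).
Proof.
rewrite -count_ascents -(permP (perm_increments_lt a m)) count_filter.
by apply: eq_count => d /=; rewrite andbC.
Qed.

(** The lists of sum exactly [m.+1] are those of sum at most [m.+1] minus those
    of sum at most [m], so the two counts differ by Pascal's rule. *)
Lemma count_ascents_eq a m l :
  count (fun d => (sumn d == m.+1) && (ascents d == l.+1)) (increments a m.+1)
  = 'C(a, l.+1) * 'C(m, l).
Proof.
apply/eqP; rewrite -(eqn_add2l ('C(a, l.+1) * 'C(m, l.+1))) -mulnDr -binS.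
rewrite -(count_ascents_lt a m) -count_ascents.
set L := increments a m.+1.
rewrite -(size_filter (fun d => ascents d == l.+1)).
rewrite -(count_predC (fun d => sumn d < m.+1)) !count_filter.
rewrite eqn_add2l; apply/eqP/eq_in_count => d; rewrite mem_increments /=.
by move=> /andP[_ le_sum]; congr (_ && _); lia.
Qed.

Lemma inj_image_card (T : eqType) (U : Type) (f : T -> U) (s : seq T) :
  uniq s -> {in s &, injective f} ->
  f @` [set x | x \in s] #= `I_(size s).
Proof.
case: s => [|x0 s0].
  move=> _ _; rewrite II0 card_eq0; apply/eqP.
  by apply/seteqP; split=> u // -[].
move: {s0}(x0 :: s0) => s us injf.
have -> : f @` [set x | x \in s] = (fun i => f (nth x0 s i)) @` `I_(size s).
  apply/seteqP; split=> [_ [x xs <-]|_ [i lti <-]].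
    by exists (index x s); [rewrite /= index_mem|rewrite nth_index].
  by exists (nth x0 s i) => //; exact: mem_nth.
apply: inj_card_eq => i j; rewrite !inE /= => lti ltj /injf.
by move=> /(_ (mem_nth _ lti) (mem_nth _ ltj))/eqP; rewrite nth_uniq // => /eqP.
Qed.

Local Open Scope ring_scope.

(** * Shifts, isomorphism classes and minimal generators *)

Definition shift (c : int) (D : set int) : set int := [set x | D (x - c)].

Lemma shift0 D : shift 0 D = D.
Proof. by apply/seteqP; split=> x; rewrite /shift /= subr0. Qed.

Lemma shift_shift c d D : shift c (shift d D) = shift (c + d) D.
Proof.
by apply/seteqP; split=> x; rewrite /shift /= opprD addrA.
Qed.

(** Iterating a nonzero shift, in one direction or the other, would take a point
    of [D] below its lower bound. *)
Lemma shift_eq0 c D : D !=set0 -> has_lbound D -> shift c D = D -> c = 0.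
Proof.
move=> [x Dx] [m lbm] cD.
have shift_iter d : shift d D = D -> forall n : nat, D (x - d * n%:Z).
  move=> dD; elim=> [|n IHn]; first by rewrite mulr0 subr0.
  by rewrite -dD in IHn; move: IHn; rewrite /shift /=; congr D; lia.
have cND : shift (- c) D = D by rewrite -{1}cD shift_shift addNr shift0.
have := lbm _ (shift_iter c cD `|x - m|.+1%N).
have := lbm _ (shift_iter _ cND `|x - m|.+1%N).
have: 0 <= (`|c| - 1) * `|x - m|.+1%N%:Z \/ c = 0 by nia.
by case: (ger0P c) => /=; lia.
Qed.

Section Semimodules.
Variable G : set nat.
Hypothesis G_numsg : numerical_semigroup G.

Lemma conductor : exists K : nat, forall n, (K <= n)%N -> G n.
Proof.
have [_ _ /finite_seqP[s sE]] := G_numsg.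
exists (\max_(i <- s) i).+1 => n ltn; apply: contrapT => nGn.
have: [set` s] n by rewrite -sE.
rewrite /= => /(leq_bigmax_seq (F := id)) => /(_ xpredT isT).
by move: ltn; rewrite ltnNge => /negP.
Qed.

Lemma semimodule_shift c D : semimodule G D -> semimodule G (shift c D).
Proof.
move=> [[x Dx] [m lbm] DG]; split.
- by exists (x + c); rewrite /shift /= addrK.
- by exists (m + c) => y /lbm; lia.
- by move=> y g Dy Gg; rewrite /shift /= addrAC; exact: DG.
Qed.

Lemma semimodule_dual D : semimodule G D -> semimodule G (dual G D).
Proof.
have [_ GD _] := G_numsg; have [K GK] := conductor.
move=> [[x Dx] [m lbm] DG]; split.
- exists (K%:Z - m) => y /lbm ley; exists `|(K%:Z - m + y)%R|%N; last by lia.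
  by apply: GK; lia.
- by exists (- x) => c /(_ _ Dx)[g _ ?]; lia.
- move=> c g dc Gg y /dc[g' Gg' cy]; exists (g' + g)%N; first exact: GD.
  by lia.
Qed.

(** Two elements [x], [y] of [D] satisfy [g + x = g' + y] for some large [g], [g']
    in [G]; applying the homomorphism [f] gives [f x - x = f y - y]. *)
Lemma isomorphicP D D' : semimodule G D ->
  isomorphic G D D' <-> exists c, D' = shift c D.
Proof.
move=> [[x Dx] _ DG]; split=> [[f [fun_f morph_f] [_ _ surj_f]]|[c ->]].
  have [K GK] := conductor; exists (f x - x).
  have fE y : D y -> f y = y + (f x - x).
    move=> Dy.
    have := morph_f (K + `|x - y|)%N x.
    have := morph_f `|(K%:Z + `|x - y| + x - y)%R|%N y.
    rewrite (_ : `|_|%N%:Z + y = (K + `|x - y|)%N%:Z + x); last by lia.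
    move=> -> //; last by apply: GK; lia.
    by move=> /(_ (GK _ _) Dx) => /(_ (leq_addr _ _)); lia.
  apply/seteqP; split=> y.
    by move=> /surj_f[z Dz <-]; rewrite /shift /= fE // addrK.
  by rewrite /shift /= => Dy; have := fun_f _ Dy; rewrite fE // subrK.
exists (fun y => y + c).
  split=> [y Dy|g y _ _]; last by rewrite addrA.
  by rewrite /shift /= addrK.
split=> [y Dy|y z _ _ /addIr //|y Dy]; first by rewrite /shift /= addrK.
by exists (y - c) => //; rewrite subrK.
Qed.

Lemma iso_class_eq D D' : semimodule G D -> semimodule G D' ->
  iso_class G D = iso_class G D' <-> exists c, D' = shift c D.
Proof.
move=> sD sD'; rewrite -isomorphicP //; split=> [clE|isoDD'].
  have : iso_class G D' D'.
    by split=> //; apply/isomorphicP => //; exists 0; rewrite shift0.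
  by rewrite -clE => -[].
apply/seteqP; split=> E [sE isoE]; split=> //; move: isoE isoDD'.
  move=> /isomorphicP -/(_ sD)[c ->] /isomorphicP -/(_ sD)[d ->].
  apply/isomorphicP; first exact: semimodule_shift.
  by exists (c - d); rewrite shift_shift subrK.
move=> /isomorphicP -/(_ sD')[c ->] /isomorphicP -/(_ sD)[d ->].
by apply/isomorphicP => //; exists (c + d); rewrite shift_shift.
Qed.

Definition min_generators (D : set int) : set int :=
  [set x | D x /\ forall g : nat, G g -> D (x - g%:Z) -> g = 0%N].

Lemma generating_min_generators D : semimodule G D ->
  generating_system G D (min_generators D).
Proof.
have [G0 GD _] := G_numsg; move=> [_ [m lbm] DG].
split=> [x []//|]; apply/seteqP; split=> [_ [x [Dx _] [g Gg <-]]|x Dx].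
  exact: DG.
have [n le_n] := ubnP `|x - m|%N.
elim: n x Dx le_n => // n IHn x Dx; rewrite ltnS => le_n.
have [xmin|] := pselect (min_generators D x).
  by exists x => //; exists 0%N => //; rewrite addr0.
move=> nmin; have [g [Gg Dxg g_gt0]] :
    exists g : nat, [/\ G g, D (x - g%:Z) & (0 < g)%N].
  apply: contrapT => noex; apply: nmin; split=> // g Gg Dxg.
  apply/eqP; rewrite -leqn0 leqNgt; apply/negP => g_gt0.
  by apply: noex; exists g.
have [|y ymin [h Gh eh]] := IHn _ Dxg.
  by have := lbm _ Dx; have := lbm _ Dxg; lia.
exists y => //; exists (h + g)%N; first exact: GD.
by lia.
Qed.

(** With [generating_min_generators], this makes [min_generators D] the only
    minimal system of generators of [D]. *)
Lemma sub_min_generators D E : generating_system G D E ->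
  min_generators D `<=` E.
Proof.
move=> [ED genE] x [Dx xmin]; move: (Dx); rewrite -genE => -[e Ee [g Gg xE]].
have g0 : g = 0%N by apply: xmin => //; rewrite -xE addrK; exact: ED.
by rewrite -xE g0 addr0.
Qed.

Lemma has_num_generatorsP k D : semimodule G D ->
  has_num_generators G k D <-> min_generators D #= `I_k.
Proof.
move=> sD; split=> [[E [genE minE] cardE]|cardM].
  suff -> : min_generators D = E by [].
  by apply: minE; [exact: sub_min_generators|exact: generating_min_generators].
exists (min_generators D) => //; split; first exact: generating_min_generators.
move=> E subE genE; apply/seteqP; split=> //; exact: sub_min_generators.
Qed.

Lemma has_num_generators_shift k c D : semimodule G D ->
  has_num_generators G k (shift c D) <-> has_num_generators G k D.
Proof.
move=> sD; rewrite !has_num_generatorsP //; last exact: semimodule_shift.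
have -> : min_generators (shift c D) = (fun x => x + c) @` min_generators D.
  apply/seteqP; split=> [x [Dx xmin]|_ [x [Dx xmin] <-]].
    exists (x - c); rewrite ?subrK //; split=> // g Gg Dxg; apply: xmin => //.
    by rewrite /shift /= addrAC.
  split=> [|g Gg]; first by rewrite /shift /= addrK.
  rewrite /shift /= (_ : x + c - g%:Z - c = x - g%:Z); last by lia.
  exact: xmin.
have cardE : (fun x => x + c) @` min_generators D #= min_generators D.
  by apply: inj_card_eq => x y _ _ /addIr.
by rewrite (card_eql cardE).
Qed.

End Semimodules.

(** * Duality over a semigroup with two generators *)

(** The reflection [x |-> N - x] exchanges [D] and its complement: for a set of
    lattice points above a path, the path is invariant under a half-turn, whose
    centre is [N / 2]. *)
Definition antisymmetric_about (N : int) (D : set int) : Prop :=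
  forall x, D x <-> ~ D (N - x).

Lemma antisymmetric_shift N c D :
  antisymmetric_about N D -> antisymmetric_about (N + c *+ 2) (shift c D).
Proof.
by move=> symD x; rewrite /shift /= symD (_ : N - _ = N + c *+ 2 - x - c) //; lia.
Qed.

(** The composition of two half-turns about different centres would be a nonzero
    shift preserving [D]. *)
Lemma antisymmetric_center_unique N N' D : D !=set0 -> has_lbound D ->
  antisymmetric_about N D -> antisymmetric_about N' D -> N = N'.
Proof.
move=> D0 lbD symD symD'; apply/eqP; rewrite -subr_eq0; apply/eqP.
apply: (shift_eq0 D0 lbD); apply/seteqP; split=> x; rewrite /shift /=.
  by rewrite symD' => nD; rewrite symD => D1; apply: nD; move: D1; congr D; lia.
rewrite symD => nD; rewrite symD' => D1; apply: nD; move: D1; congr D; lia.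
Qed.

(** Otherwise the fixed point [M] of the reflection would be both in [D] and
    outside it. *)
Lemma antisymmetric_center_odd N D : antisymmetric_about N D ->
  forall M : int, N <> M *+ 2.
Proof.
move=> symD M eN; have := symD M; rewrite eN mulr2n addrK; tauto.
Qed.

Definition lattice_pt (alpha beta : nat) (i j : int) : int :=
  i * beta%:Z + j * alpha%:Z.

Section TwoGenerators.
Variables alpha beta : nat.
Local Notation pt := (lattice_pt alpha beta).
Hypothesis alpha_gt0 : (0 < alpha)%N.
Hypothesis beta_gt0 : (0 < beta)%N.
Hypothesis co_alpha_beta : coprime alpha beta.
Let G := semigroup2 alpha beta.
Let G_numsg : numerical_semigroup G :=
  numerical_semigroup2 alpha_gt0 beta_gt0 co_alpha_beta.

Lemma pt_inj (i i' j j' : int) : `|i - i'| < alpha%:Z -> pt i j = pt i' j' ->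
  i = i' /\ j = j'.
Proof.
move=> lt_i; rewrite /lattice_pt => eqp.
have /dvdzP[q qE] : (alpha %| i - i')%Z.
  rewrite -(@Gauss_dvdzl _ _ beta) //; apply/dvdzP; exists (j' - j).
  by lia.
have q0 : q = 0 by nia.
have ei : i = i' by lia.
split=> //; apply: (@mulIf _ alpha%:Z); first by lia.
by rewrite ei in eqp; lia.
Qed.

Lemma pt_window (m x : int) :
  exists i j, [/\ m <= i, i < m + alpha%:Z & x = pt i j].
Proof.
have [u [v uv]] := Bezoutz alpha beta.
have {}uv : u * alpha%:Z + v * beta%:Z = 1.
  by rewrite uv; apply/eqP; exact: co_alpha_beta.
pose q := ((x * v - m) %/ alpha)%Z.
exists (m + ((x * v - m) %% alpha)%Z), (x * u + q * beta%:Z).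
have a0 : alpha%:Z != 0 by lia.
have := modz_ge0 (x * v - m) a0; have := ltz_pmod (x * v - m) (alpha_gt0 : 0 < alpha%:Z).
have := divz_eq (x * v - m) alpha; rewrite -/q.
move: (modz _ _) => r eqr ltr ger; split; [lia|lia|].
rewrite /lattice_pt -[LHS]mulr1 -uv.
have -> : m + r = x * v - q * alpha%:Z by lia.
lia.
Qed.

(** A representation [r * alpha + s * beta] with natural coefficients stays one
    when [s] is reduced modulo [alpha], and is then the only one with second
    coefficient in the window [0 <= i < alpha]. *)
Lemma semigroup2_pt i j : 0 <= i -> i < alpha%:Z ->
  (exists2 g : nat, G g & pt i j = g%:Z) <-> 0 <= j.
Proof.
move=> i_ge0 lt_i; split=> [[_ [r [s ->]] eqg]|j_ge0].
  have /pt_inj[|_ ->] // :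
      pt i j = pt (s %% alpha)%N (r + (s %/ alpha) * beta)%N.
    by rewrite eqg /lattice_pt {1}(divn_eq s alpha); lia.
  by have := ltn_pmod s alpha_gt0; lia.
exists (`|j| * alpha + `|i| * beta)%N; first by exists `|j|%N, `|i|%N.
by rewrite /lattice_pt; lia.
Qed.

(** The subtracted point is the Frobenius number [alpha * beta - alpha - beta].
    The reflection about it maps column [i] of the window [0 <= i < alpha] to
    column [alpha - 1 - i] and height [j] to [- 1 - j], so by [semigroup2_pt] it
    exchanges [G] and its complement; and [c + x] is outside [G] for some [x] in
    [D] exactly when the reflection of [c] lies in [D + G = D]. *)
Lemma dual_semigroup2 D : semimodule G D ->
  dual G D = [set c | ~ D (pt (alpha%:Z - 1) (- 1) - c)].
Proof.
move=> [_ _ DG]; apply/seteqP; split=> [c dc /dc[g Gg] | c nD x Dx].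
  rewrite addrC subrK => eF.
  suff: (0 <= - 1 :> int) by [].
  by apply/(@semigroup2_pt (alpha%:Z - 1)); [lia|lia|exists g].
have [i [j [i_ge0 lt_i eqp]]] := pt_window 0 (c + x).
rewrite add0r in lt_i; rewrite eqp; apply/semigroup2_pt => //.
rewrite leNgt; apply/negP => j_lt0; apply: nD.
have [g Gg eg] : exists2 g : nat, G g & pt (alpha%:Z - 1 - i) (- 1 - j) = g%:Z.
  by apply/semigroup2_pt; lia.
have := DG _ _ Dx Gg; congr D; rewrite -eg; move: eqp; rewrite /lattice_pt; lia.
Qed.

(** By [dual_semigroup2], an isomorphism from the dual, which is a shift, is the
    same as a reflection exchanging [D] and its complement. *)
Lemma selfdualP D : selfdual G D <->
  semimodule G D /\ exists N, antisymmetric_about N D.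
Proof.
have iso (sD : semimodule G D) := isomorphicP G_numsg D (semimodule_dual G_numsg sD).
split=> -[sD]; [move/(iso sD)|]; rewrite ?dual_semigroup2 //.
  move=> [c eD]; split=> //; exists (pt (alpha%:Z - 1) (- 1) + c) => x.
  by rewrite {1}eD /shift /= opprB addrA addrAC.
move=> [N symD]; split=> //; apply/(iso sD); rewrite dual_semigroup2 //.
exists (N - pt (alpha%:Z - 1) (- 1)); apply/seteqP; split=> x; rewrite /shift /= (symD x).
  by apply: contra_not; congr D; lia.
by apply: contra_not; congr D; lia.
Qed.

Lemma semimodule_closed D : D !=set0 -> has_lbound D ->
  (forall x, D x -> D (x + alpha%:Z)) -> (forall x, D x -> D (x + beta%:Z)) ->
  semimodule G D.
Proof.
move=> D0 lbD Da Db; split=> // x _ Dx [r [s ->]].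
elim: s => [|s IHs]; last by have := Db _ IHs; congr D; lia.
elim: r => [|r IHr]; first by rewrite addr0.
by have := Da _ IHr; congr D; lia.
Qed.

Lemma min_generators2 D x : semimodule G D ->
  min_generators G D x <-> [/\ D x, ~ D (x - alpha%:Z) & ~ D (x - beta%:Z)].
Proof.
move=> [_ _ DG]; split=> [[Dx xmin]|[Dx nDa nDb]].
  split=> // Dxg.
    have Ga : G alpha by exists 1%N, 0%N; lia.
    by have := xmin _ Ga Dxg; lia.
  have Gb : G beta by exists 0%N, 1%N; lia.
  by have := xmin _ Gb Dxg; lia.
split=> // _ [r [s ->]] Dxg.
case: r Dxg => [|r] Dxg; last first.
  case: nDa.
  have := DG _ (r * alpha + s * beta)%N Dxg (ex_intro _ r (ex_intro _ s erefl)).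
  by congr D; lia.
case: s Dxg => [|s] // Dxg; case: nDb.
have := DG _ (0 * alpha + s * beta)%N Dxg (ex_intro _ 0%N (ex_intro _ s erefl)).
by congr D; lia.
Qed.

End TwoGenerators.

(** * Normalised selfdual semimodules as staircases *)

Lemma sumn_takeS d n : sumn (take n.+1 d) = (sumn (take n d) + nth 0 d n)%N.
Proof.
elim: d n => [|v d IHd] [|n] //=; last by rewrite -addnA -IHd.
by rewrite take0 addn0.
Qed.

Lemma leq_sumn_take d n : (sumn (take n d) <= sumn d)%N.
Proof. by rewrite -{2}(cat_take_drop n d) sumn_cat leq_addr. Qed.

(** The partial sums of the increments, extended to negative integers as an odd
    function; [- profile d i] is the height of the staircase in column [i]. *)
Definition profile (d : seq nat) (i : int) : int :=
  if 0 <= i then (sumn (take `|i|%N d))%:Z else - (sumn (take `|i|%N d))%:Z.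

Lemma profile_nat d (n : nat) : profile d n%:Z = (sumn (take n d))%:Z.
Proof. by []. Qed.

Lemma profileN d i : profile d (- i) = - profile d i.
Proof.
rewrite /profile abszN; case: (ltrgt0P i) => [i_gt0|i_lt0|->].
- by rewrite ifF //; lia.
- by rewrite opprK ifT //; lia.
- by rewrite oppr0 absz0 take0.
Qed.

(** The step from [i] to [i + 1] on the left of 0 is the mirror image of the step
    from [- i - 1] to [- i]. *)
Lemma profileD1 d i :
  profile d (i + 1) =
    profile d i + (nth 0%N d (if 0 <= i then `|i|%N else (`|i| - 1)%N))%:Z.
Proof.
case: (lerP 0 i) => [i_ge0|i_lt0].
  have -> : i = `|i|%N by lia.
  by rewrite -PoszD addn1 !profile_nat sumn_takeS absz_nat PoszD.
have -> : i = - (`|i| - 1).+1%N%:Z by lia.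
rewrite profileN (_ : _ + 1 = - (`|i| - 1)%N%:Z); last by lia.
by rewrite profileN !profile_nat sumn_takeS abszN absz_nat subSS subn0; lia.
Qed.

Lemma profile_bounds d i : - (sumn d)%:Z <= profile d i <= (sumn d)%:Z.
Proof. by have := leq_sumn_take d `|i|; rewrite /profile; case: ifP; lia. Qed.

Section Staircases.
Variables alpha beta a b : nat.
Hypothesis alphaE : alpha = a.*2.+1.
Hypothesis betaE : beta = b.*2.
Hypothesis b_gt0 : (0 < b)%N.
Hypothesis co_alpha_beta : coprime alpha beta.
Let alpha_gt0 : (0 < alpha)%N.
Proof. by rewrite alphaE. Qed.
Let beta_gt0 : (0 < beta)%N.
Proof. by rewrite betaE double_gt0. Qed.
Let G := semigroup2 alpha beta.
Let G_numsg : numerical_semigroup G :=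
  numerical_semigroup2 alpha_gt0 beta_gt0 co_alpha_beta.
Local Notation pt := (lattice_pt alpha beta).

Definition staircase (d : seq nat) : set int :=
  [set x | exists i j, [/\ `|i| <= a%:Z, - profile d i <= j & x = pt i j]].

Lemma centered_coordinates x : exists i j, `|i| <= a%:Z /\ x = pt i j.
Proof.
have [i [j [lei lti ->]]] := pt_window alpha_gt0 beta_gt0 co_alpha_beta (- a%:Z) x.
by exists i, j; split=> //; lia.
Qed.

Lemma staircase_pt d i j : `|i| <= a%:Z ->
  staircase d (pt i j) <-> - profile d i <= j.
Proof.
move=> lei; split=> [[i' [j' [lei' lej']]]|lej]; last by exists i, j.
by move=> /(pt_inj alpha_gt0 beta_gt0 co_alpha_beta)[|-> ->] //; lia.
Qed.

(** The two coordinate pairs differ by the period [(alpha, - beta)] of the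
    coordinates. *)
Lemma pt_wrap j : pt (- a%:Z - 1) j = pt a%:Z (j - beta%:Z).
Proof. by rewrite /lattice_pt alphaE; lia. Qed.

(** Within the window, stability under [beta] is the monotonicity of the profile;
    at the right end it is the inequality [2 * sumn d <= beta]. *)
Lemma staircase_semimodule d : size d = a -> (sumn d <= b)%N ->
  semimodule G (staircase d).
Proof.
move=> sz_d le_d; apply: (semimodule_closed alpha_gt0 beta_gt0 co_alpha_beta).
- by exists (pt 0 0); apply/staircase_pt; rewrite ?profile_nat ?take0.
- exists (pt (- a%:Z) (- b%:Z)) => _ [i [j [lei lej ->]]].
  by have := profile_bounds d i; rewrite /lattice_pt; nia.
- move=> _ [i [j [lei lej ->]]]; exists i, (j + 1).
  by rewrite /lattice_pt; split=> //; lia.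
move=> _ [i [j [lei lej ->]]].
have [ia|neq_ia] := eqVneq i a%:Z.
  exists (- a%:Z), (j + beta%:Z); split; [lia| |].
    rewrite profileN opprK; move: lej; rewrite ia profile_nat.
    by have := leq_sumn_take d a; lia.
  by rewrite ia /lattice_pt alphaE; lia.
exists (i + 1), j; split; [lia| |by rewrite /lattice_pt; lia].
by rewrite profileD1; lia.
Qed.

Lemma staircase_antisymmetric d : antisymmetric_about (- alpha%:Z) (staircase d).
Proof.
move=> x; have [i [j [lei ->]]] := centered_coordinates x.
have -> : - alpha%:Z - pt i j = pt (- i) (- 1 - j) by rewrite /lattice_pt; lia.
rewrite !staircase_pt ?normrN // profileN.
by split=> [?|/negP]; [apply/negP|]; lia.
Qed.

(** A nonzero increment from column [k] to [k + 1] yields a corner in column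
    [k + 1] and, by the mirror step from [- k - 1] to [- k], one in column
    [- k].  Column [- a] is compared with column [a] across the seam of the
    period, where the drop is [2 * (b - sumn d)]. *)
Definition corner_columns (d : seq nat) : seq int :=
  let steps := [seq k <- iota 0 a | (0 < nth 0 d k)%N] in
  [seq - (k%:Z) | k <- steps] ++ [seq k.+1%:Z | k <- steps] ++
  (if (sumn d < b)%N then [:: - a%:Z] else [::]).

Lemma size_corner_columns d : size d = a ->
  size (corner_columns d) = (2 * ascents d + (sumn d < b))%N.
Proof.
move=> sz_d; rewrite !size_cat !size_map size_filter.
have -> : count (fun k => 0 < nth 0 d k)%N (iota 0 a) = ascents d.
  rewrite /ascents -{2}(mkseq_nth 0%N d) sz_d count_map.
  by apply: eq_count.
by case: ifP => _ /=; lia.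
Qed.

Lemma mem_corner_columns d (i : int) : (i \in corner_columns d) =
  if i == - a%:Z then (sumn d < b)%N else
  (`|i| <= a%:Z) && (0 < nth 0 d (if (0 < i)%R then `|i| - 1 else `|i|))%N.
Proof.
rewrite /corner_columns; set steps := [seq _ <- _ | _].
have mem_steps k : (k \in steps) = (k < a)%N && (0 < nth 0 d k)%N.
  by rewrite mem_filter mem_iota andbC.
have in_neg : (i \in [seq - (k%:Z) | k <- steps]) = (i <= 0) && (`|i|%N \in steps).
  apply/mapP/andP => [[k ks ->]|[i_le0 ins]].
    by rewrite abszN absz_nat; split=> //; lia.
  by exists `|i|%N => //; lia.
have in_pos : (i \in [seq k.+1%:Z | k <- steps]) = (0 < i) && ((`|i| - 1)%N \in steps).
  apply/mapP/andP => [[k ks ->]|[i_gt0 ins]].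
    by rewrite absz_nat subSS subn0; split=> //; lia.
  by exists (`|i| - 1)%N => //; lia.
rewrite !mem_cat in_neg in_pos !mem_steps.
have -> : (i \in (if (sumn d < b)%N then [:: - a%:Z] else [::])) =
    (i == - a%:Z) && (sumn d < b)%N.
  by case: ifP; rewrite ?inE ?in_nil ?andbT ?andbF.
case: eqP => [->|nia] /=; first by rewrite abszN absz_nat; lia.
case: ltrP => i0; lia.
Qed.

Lemma uniq_corner_columns d : uniq (corner_columns d).
Proof.
have us : uniq [seq k <- iota 0 a | (0 < nth 0 d k)%N].
  by rewrite filter_uniq ?iota_uniq.
rewrite /corner_columns !cat_uniq !map_inj_uniq ?us //=; last 2 first.
- by move=> k k'; lia.
- by move=> k k'; lia.
apply/and3P; split; last by case: ifP.
  apply/hasPn => i; rewrite mem_cat => /orP[/mapP[k ks ->]|].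
    by apply/mapP => -[k' _]; lia.
  case: ifP => // _; rewrite inE => /eqP ->; apply/mapP => -[k].
  by rewrite mem_filter mem_iota; lia.
apply/hasPn => i; case: ifP => // _; rewrite inE => /eqP ->.
by apply/mapP => -[k]; lia.
Qed.

(** A point is minimal when it lies at the bottom of its column and the column to
    its left is strictly higher. *)
Lemma min_generators_staircase d : size d = a -> (sumn d <= b)%N ->
  min_generators G (staircase d) =
    (fun i => pt i (- profile d i)) @` [set i | i \in corner_columns d].
Proof.
move=> sz_d le_d.
have minE i j : `|i| <= a%:Z ->
    min_generators G (staircase d) (pt i j) <->
    j = - profile d i /\ i \in corner_columns d.
  move=> lei; rewrite (min_generators2 alpha_gt0 beta_gt0 co_alpha_beta);
    last exact: staircase_semimodule.
  have -> : pt i j - alpha%:Z = pt i (j - 1) by rewrite /lattice_pt; lia.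
  have -> : pt i j - beta%:Z = pt (i - 1) j by rewrite /lattice_pt; lia.
  have stairE i' j' := fun lei' => propext (@staircase_pt d i' j' lei').
  rewrite mem_corner_columns lei; case: eqP => [ia|nia].
    rewrite ia pt_wrap !stairE; try lia.
    rewrite !profileN profile_nat -sz_d take_size.
    split=> [[]|[-> ?]]; first by split; lia.
    by split; lia.
  rewrite !stairE; try lia.
  have := profileD1 d (i - 1); rewrite subrK.
  have -> : (if 0 <= i - 1 then `|i - 1|%N else (`|i - 1| - 1)%N) =
      (if 0 < i then (`|i| - 1)%N else `|i|%N) by case: ifP; case: ifP; lia.
  by move=> ->; split=> [[]|[-> ?]]; split; lia.
apply/seteqP; split=> [x|_ [i ic <-]].
  have [i [j [lei ->]]] := centered_coordinates x.
  by move=> /minE -/(_ lei)[-> ic]; exists i.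
apply/minE => //; move: ic; rewrite /= mem_corner_columns.
by case: eqP => [->|_ /andP[]//]; lia.
Qed.

Lemma has_num_generators_staircase k d : size d = a -> (sumn d <= b)%N ->
  has_num_generators G k (staircase d) <-> k = (2 * ascents d + (sumn d < b))%N.
Proof.
move=> sz_d le_d.
rewrite has_num_generatorsP //; last exact: staircase_semimodule.
rewrite min_generators_staircase // -size_corner_columns //.
have cardE : (fun i => pt i (- profile d i)) @` [set i | i \in corner_columns d]
    #= `I_(size (corner_columns d)).
  apply: inj_image_card; first exact: uniq_corner_columns.
  have lea i : i \in corner_columns d -> `|i| <= a%:Z.
    by rewrite mem_corner_columns; case: eqP => [->|_ /andP[]//]; lia.
  move=> i i' /lea lei /lea lei' /(pt_inj alpha_gt0 beta_gt0 co_alpha_beta)[] //.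
  by rewrite alphaE; lia.
rewrite (card_eql cardE); split=> [/card_eq_II -> //|->].
exact/card_eq_II.
Qed.

Lemma staircase_inj d d' : size d = a -> size d' = a ->
  staircase d = staircase d' -> d = d'.
Proof.
move=> sz_d sz_d' eqS.
have eqp n : (n <= a)%N -> sumn (take n d) = sumn (take n d').
  move=> len; have len' : `|n%:Z| <= a%:Z by [].
  have := staircase_pt d (- (sumn (take n d))%:Z) len'.
  have := staircase_pt d (- (sumn (take n d'))%:Z) len'.
  rewrite eqS !staircase_pt // !profile_nat; lia.
apply: (@eq_from_nth _ 0%N); first by rewrite sz_d.
move=> n; rewrite sz_d => ltn; have := eqp n.+1 ltn; rewrite !sumn_takeS.
by have := eqp n (ltnW ltn); lia.
Qed.

(** The profile is read off the depths [p n] of the columns [n >= 0] of [D]; the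
    antisymmetry then gives the columns [n < 0]. *)
Lemma antisymmetric_staircase D : semimodule G D ->
  antisymmetric_about (- alpha%:Z) D ->
  exists2 d, size d = a /\ (sumn d <= b)%N & D = staircase d.
Proof.
move=> [_ [m lbm] DG] symD.
have D_pt i i' j j' : i <= i' -> j <= j' -> D (pt i j) -> D (pt i' j').
  move=> lei lej Dij.
  have := DG _ (`|j' - j| * alpha + `|i' - i| * beta)%N Dij.
  move=> /(_ (ex_intro _ `|j' - j|%N (ex_intro _ `|i' - i|%N erefl))).
  by congr D; rewrite /lattice_pt; lia.
have sym_pt i j : D (pt i j) <-> ~ D (pt (- i) (- 1 - j)).
  by rewrite symD (_ : - alpha%:Z - _ = pt (- i) (- 1 - j)) // /lattice_pt; lia.
(* The half-turn exchanges [pt 0 0] and the point below it. *)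
have D0 : D (pt 0 0).
  by apply/sym_pt => Da; apply/(sym_pt 0 0): (Da); apply: D_pt Da.
have /choice[p pP] : forall n : nat, exists pn : nat, forall k : nat,
    D (pt n%:Z (- k%:Z)) <-> (k <= pn)%N.
  move=> n.
  pose P k := `[< D (pt n%:Z (- k%:Z)) >].
  have exP : exists k, P k.
    by exists 0%N; apply/asboolP; apply: D_pt D0.
  have boundP k : P k -> (k <= `|(pt n%:Z 0 - m)%R|)%N.
    by move=> /asboolP /lbm; rewrite /lattice_pt; nia.
  case: (ex_maxnP exP boundP) => pn /asboolP Dpn maxpn; exists pn => k.
  split=> [Dk|lek]; first by apply: maxpn; exact/asboolP.
  by apply: D_pt Dpn => //; lia.
have p0 : p 0%N = 0%N.
  apply/eqP; rewrite -leqn0 leqNgt; apply/negP => /pP D1.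
  exact: (sym_pt 0 0).1 D1.
have p_mono n : (p n <= p n.+1)%N.
  apply/pP/(D_pt n%:Z n.+1%:Z (- (p n)%:Z)) => //; first by lia.
  exact/pP.
have pa : (p a <= b)%N.
  (* If the depth of column [a] exceeded [b], the half-turn would exclude the
     point [pt (- a) b], which is the point [pt (a + 1) (- b)]. *)
  rewrite leqNgt; apply/negP => lt_b; have /pP/sym_pt := lt_b; apply.
  have -> : pt (- a%:Z) (- 1 - - b.+1%:Z) = pt a.+1%:Z (- b%:Z).
    by rewrite /lattice_pt alphaE betaE; lia.
  by apply: (D_pt a%:Z _ (- (p a)%:Z)); [lia|lia|apply/pP].
pose d := mkseq (fun n => p n.+1 - p n)%N a.
have sz_d : size d = a by rewrite size_mkseq.
have take_d n : (n <= a)%N -> sumn (take n d) = p n.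
  elim: n => [|n IHn] len; first by rewrite take0.
  by rewrite sumn_takeS IHn ?(ltnW len) // nth_mkseq // subnKC.
have dE n j : (n <= a)%N -> D (pt n%:Z j) <-> - (sumn (take n d))%:Z <= j.
  move=> len; rewrite take_d //; case: (lerP 0 j) => j0.
    by split=> _; [lia|apply: D_pt D0].
  have -> : j = - `|j|%N%:Z by lia.
  by rewrite pP; lia.
exists d; first by split=> //; rewrite -[d]take_size sz_d take_d.
have staircaseE i j : `|i| <= a%:Z -> D (pt i j) <-> staircase d (pt i j).
  move=> lei; rewrite staircase_pt //; case: (lerP 0 i) => i0.
    have -> : i = `|i|%N by lia.
    by rewrite profile_nat dE //; lia.
  have -> : i = - `|i|%N%:Z by lia.
  rewrite sym_pt opprK profileN profile_nat dE; last by lia.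
  by split=> [/negP|?]; [|apply/negP]; lia.
apply/seteqP; split=> x; have [i [j [lei ->]]] := centered_coordinates x;
  by move/(staircaseE _ _ lei).
Qed.

Lemma staircase_selfdual d : size d = a -> (sumn d <= b)%N ->
  selfdual G (staircase d).
Proof.
move=> sz_d le_d; apply/(selfdualP alpha_gt0 beta_gt0 co_alpha_beta); split.
  exact: staircase_semimodule.
by exists (- alpha%:Z); exact: staircase_antisymmetric.
Qed.

(** The reflections have odd [N] and [- alpha], and a shift by [c] adds [2c] to
    [N], so half the difference is the shift that is needed. *)
Lemma selfdual_staircase D : selfdual G D ->
  exists c d, d \in increments a b /\ shift c D = staircase d.
Proof.
move=> /(selfdualP alpha_gt0 beta_gt0 co_alpha_beta)[sD [N symD]].
have [c cE] : exists c, N + c *+ 2 = - alpha%:Z.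
  have N_odd := antisymmetric_center_odd symD.
  exists (- ((N + alpha%:Z) %/ 2)%Z).
  have := divz_eq N 2; have := N_odd (N %/ 2)%Z.
  lia.
have sDc := semimodule_shift c sD.
have symDc := antisymmetric_shift c symD; rewrite cE in symDc.
have [d [sz_d le_d] eqD] := antisymmetric_staircase sDc symDc.
by exists c, d; rewrite mem_increments sz_d eqxx.
Qed.

(** Staircases represent the isomorphism classes of selfdual semimodules without
    repetition: two isomorphic ones have the same centre, so they are equal. *)
Lemma num_selfdual (P : set (set int)) (Q : pred (seq nat)) :
  (forall D, P D -> selfdual G D) ->
  (forall c D, P D -> P (shift c D)) ->
  (forall d, size d = a -> (sumn d <= b)%N -> P (staircase d) <-> Q d) ->
  num_up_to_iso G P (count Q (increments a b)).
Proof.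
move=> P_selfdual P_shift PQ; rewrite -size_filter.
set L := filter Q _.
have memL d : d \in L -> [/\ size d = a, (sumn d <= b)%N & Q d].
  by rewrite mem_filter mem_increments => /and3P[? /eqP ? ?].
have sS d : d \in L -> semimodule G (staircase d).
  by move=> /memL[? ? _]; exact: staircase_semimodule.
rewrite /num_up_to_iso (_ : _ @` P = (iso_class G \o staircase) @` [set d | d \in L]).
  apply: inj_image_card => [|d d' dL d'L].
    by rewrite filter_uniq ?uniq_increments.
  move=> /(iso_class_eq G_numsg (sS _ dL) (sS _ d'L))[c eqS].
  have [S0 lbS _] := sS _ d'L.
  have [[sz_d _ _] [sz_d' _ _]] := (memL _ dL, memL _ d'L).
  have symS := @staircase_antisymmetric d'.
  have := antisymmetric_shift c (@staircase_antisymmetric d); rewrite -eqS.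
  move=> /(antisymmetric_center_unique S0 lbS symS) c0.
  apply: staircase_inj => //; rewrite eqS (_ : c = 0) ?shift0 //.
  by lia.
apply/seteqP; split=> [_ [D PD <-]|_ [d /memL[sz_d le_d Qd] <-]]; last first.
  by exists (staircase d) => //; apply/PQ.
have [c [d [dI eqD]]] := selfdual_staircase (P_selfdual _ PD).
move: (dI); rewrite mem_increments => /andP[/eqP sz_d le_d].
exists d.
  by rewrite /= mem_filter dI andbT; apply/PQ => //; rewrite -eqD; exact: P_shift.
have [sD _] := P_selfdual _ PD.
rewrite /= -eqD; apply/esym/(iso_class_eq G_numsg) => //.
  exact: semimodule_shift.
by exists c.
Qed.

Lemma selfdual_shift c D : selfdual G D -> selfdual G (shift c D).
Proof.
move=> /(selfdualP alpha_gt0 beta_gt0 co_alpha_beta)[sD [N symD]].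
apply/(selfdualP alpha_gt0 beta_gt0 co_alpha_beta).
split; first exact: semimodule_shift.
by exists (N + c *+ 2); exact: antisymmetric_shift.
Qed.

Lemma num_selfdual_generators k : num_up_to_iso G
  [set D | selfdual G D /\ has_num_generators G k D]
  (count (fun d => k == 2 * ascents d + (sumn d < b)) (increments a b))%N.
Proof.
apply: num_selfdual => [D []//|c D [sdD kD]|d sz_d le_d].
  split; first exact: selfdual_shift.
  by apply/has_num_generators_shift => //; case: sdD.
rewrite /= has_num_generators_staircase //.
by split=> [[_ /eqP]|/eqP]; last by split; first exact: staircase_selfdual.
Qed.

Lemma num_selfdual_total : num_up_to_iso G [set D | selfdual G D] 'C(a + b, a).
Proof.
rewrite -size_increments -count_predT; apply: num_selfdual => // [c D|d sz_d le_d].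
  exact: selfdual_shift.
by split=> // _; exact: staircase_selfdual.
Qed.

Lemma num_selfdual_odd l : num_up_to_iso G
  [set D | selfdual G D /\ has_num_generators G (2 * l + 1) D]
  ('C(a, l) * 'C(b - 1, l)).
Proof.
have b1 : b = (b - 1).+1 by lia.
rewrite -count_ascents_lt -b1.
rewrite (_ : count _ _ =
  count (fun d => 2 * l + 1 == 2 * ascents d + (sumn d < b))%N (increments a b)).
  exact: num_selfdual_generators.
by apply: eq_count => d; case: ltnP => _ /=; lia.
Qed.

Lemma num_selfdual_even l : (0 < l)%N -> num_up_to_iso G
  [set D | selfdual G D /\ has_num_generators G (2 * l) D]
  ('C(a, l) * 'C(b - 1, l - 1)).
Proof.
case: l => // l _; have b1 : b = (b - 1).+1 by lia.
rewrite [(l.+1 - 1)%N]subn1 -count_ascents_eq -b1.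
rewrite (_ : count _ _ =
  count (fun d => 2 * l.+1 == 2 * ascents d + (sumn d < b))%N (increments a b)).
  exact: num_selfdual_generators.
apply: eq_in_count => d; rewrite mem_increments => /andP[_ le_d].
by case: (ltngtP (sumn d) b) le_d => //= _ _; lia.
Qed.

End Staircases.

Local Open Scope nat_scope.

Theorem theorem5p4 (alpha beta : nat) (alpha_gt0 : 0 < alpha)
    (lt_alpha_beta : alpha < beta) (co_alpha_beta : coprime alpha beta)
    (odd_alpha : odd alpha) (even_beta : ~~ odd beta) :
  let G := semigroup2 alpha beta in
  [/\ num_up_to_iso G [set D | selfdual G D]
        'C(alpha %/ 2 + beta %/ 2, alpha %/ 2),
      forall l : nat, l <= alpha %/ 2 ->
        num_up_to_iso G
          [set D | selfdual G D /\ has_num_generators G (2 * l + 1) D]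
          ('C(alpha %/ 2, l) * 'C(beta %/ 2 - 1, l))
    & forall l : nat, 1 <= l <= alpha %/ 2 ->
        num_up_to_iso G
          [set D | selfdual G D /\ has_num_generators G (2 * l) D]
          ('C(alpha %/ 2, l) * 'C(beta %/ 2 - 1, l - 1))].
Proof.
have alphaE : alpha = (alpha %/ 2).*2.+1 by lia.
have betaE : beta = (beta %/ 2).*2 by lia.
have b_gt0 : 0 < beta %/ 2 by lia.
split=> [|l _|l /andP[l_gt0 _]].
- exact: num_selfdual_total.
- exact: num_selfdual_odd.
- exact: num_selfdual_even.
Qed.
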